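(* Let $J, D \in \mathbb{R}^{d\times d}$ satisfy $J^{\mathrm T} = -J$, $D^{\mathrm T} = D$ and $JD = DJ$, let $V:\mathbb{R}^d\to\mathbb{R}$ be twice continuously differentiable, and set $A = JD$ and $f(q) = J\nabla V(q)$. The exponential midpoint rule with timestep $h$ preserves the Poisson structure $\sum_{i,j} J_{ij}\frac{\partial}{\partial x_i}\otimes\frac{\partial}{\partial x_j}$ when applied to the semilinear Poisson system $\dot q = Aq + f(q) = J(Dq+\nabla V(q))$. That is: for every $h\in\mathbb{R}$, if $U\subseteq\mathbb{R}^d$ is open and $\phi:U\to\mathbb{R}^d$ is a differentiable map such that for all $q\in U$ $$\phi(q) = e^{Ah}q + h\, e^{A\frac{h}{2}} f\Big(\frac{e^{A\frac{h}{2}}q + e^{-A\frac{h}{2}}\phi(q)}{2}\Big),$$ then $(\nabla\phi(q))\,J\,(\nabla\phi(q))^{\mathrm T} = J$ for all $q\in U$.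
   Context: Here $\nabla\phi(q)$ denotes the Jacobian matrix of $\phi$ at $q$, and $e^{M}$ denotes the matrix exponential. For the semilinear system $\dot q = Aq+f(q)$, the exponential midpoint rule with timestep $h$ is the (implicit) one-step method $q_k\mapsto q_{k+1}$ defined by $$q_{k+1} = e^{Ah}q_k + h\, e^{A\frac{h}{2}} f\Big(\frac{e^{A\frac{h}{2}}q_k + e^{-A\frac{h}{2}}q_{k+1}}{2}\Big).$$ A map $\phi$ is said to preserve the constant Poisson structure $\sum_{i,j} J_{ij}\frac{\partial}{\partial x_i}\otimes\frac{\partial}{\partial x_j}$ if and only if $(\nabla\phi)J(\nabla\phi)^{\mathrm T} = J$. *)

(* Defs.v *)
From HB Require Import structures.
From mathcomp Require Import all_boot all_order all_algebra.
From mathcomp Require Import boolp classical_sets functions reals topology.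
From mathcomp Require Import normedtype sequences derive.

Set Implicit Arguments.
Unset Strict Implicit.
Unset Printing Implicit Defensive.

Import Order.TTheory GRing.Theory Num.Theory.
Import numFieldNormedType.Exports.

Local Open Scope classical_set_scope.
Local Open Scope ring_scope.

(* The series always converges, see is_cvg_mxexp: limn returns no default value. *)
Definition mxexp (R : realType) (d : nat) (M : 'M[R]_d) : 'M[R]_d :=
  limn (series (fun k : nat => (k`!%:R)^-1 *: M ^+ k)).

Definition basis_vec (R : realType) (d : nat) (j : 'I_d) : 'cV[R]_d :=
  delta_mx j ord0.

Definition gradient (R : realType) (d : nat) (V : 'cV[R]_d -> R)
    (q : 'cV[R]_d) : 'cV[R]_d :=
  \col_i 'D_(basis_vec R i) V q.

(* Entry (i, j) is the partial derivative of phi_i along x_j. Vectors are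
   columns here, whereas the library's 'J is for maps between row vectors and
   has this entry at (j, i): see jac_mxE and jac_mx_jacobian. *)
Definition jac_mx (R : realType) (d : nat) (phi : 'cV[R]_d -> 'cV[R]_d)
    (q : 'cV[R]_d) : 'M[R]_d :=
  \matrix_(i, j) 'D_(basis_vec R j) (fun x => phi x i ord0) q.

(* The derivative of V is represented by its gradient, and the derivative of
   the gradient by its Jacobian, the Hessian matrix of V. *)
Definition twice_cont_diff (R : realType) (d : nat) (V : 'cV[R]_d -> R) : Prop :=
  [/\ forall x, differentiable V x,
      forall x, differentiable (gradient V) x &
      continuous (jac_mx (gradient V))].

(* q' is a result of one step of size h from q; the method is implicit. *)
Definition exp_midpoint_step (R : realType) (d : nat) (A : 'M[R]_d)
    (f : 'cV[R]_d -> 'cV[R]_d) (h : R) (q q' : 'cV[R]_d) : Prop :=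
  q' = mxexp (h *: A) *m q +
       h *: (mxexp ((h / 2) *: A) *m
               f (2^-1 *: (mxexp ((h / 2) *: A) *m q +
                           mxexp (- (h / 2) *: A) *m q'))).

Definition preserves_poisson_at (R : realType) (d : nat) (J : 'M[R]_d)
    (phi : 'cV[R]_d -> 'cV[R]_d) (q : 'cV[R]_d) : Prop :=
  jac_mx phi q *m J *m (jac_mx phi q)^T = J.

Lemma jac_mxE (R : realType) (d : nat) (phi : 'cV[R]_d -> 'cV[R]_d)
    (q v : 'cV[R]_d) :
  differentiable phi q -> 'd phi q v = jac_mx phi q *m v.
Proof.
move=> dphi.
have jE i j : jac_mx phi q i j = 'd phi q (basis_vec R j) i ord0.
  rewrite mxE -deriveE// derive_mx ?mxE//; exact: diff_derivable.
apply/colP => i; rewrite mxE.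
under eq_bigr do rewrite jE.
rewrite [in LHS](matrix_sum_delta v) linear_sum summxE; apply: eq_bigr => j _.
by rewrite big_ord1 linearZ mxE mulrC.
Qed.

Lemma is_cvg_mxexp (R : realType) (d : nat) (M : 'M[R]_d) :
  cvgn (series (fun k : nat => (k`!%:R)^-1 *: M ^+ k)).
Proof.
have Mij (A : 'M[R]_d) i j : `|A i j| <= `|A|.
  by rewrite [leRHS]/Num.norm/= mx_normrE; exact: (le_bigmax _ _ (i, j)).
have Mle (A : 'M[R]_d) (c : R) : 0 <= c -> (forall i j, `|A i j| <= c) -> `|A| <= c.
  move=> c0 Ac; rewrite [leLHS]/Num.norm/= mx_normrE; apply/bigmax_leP.
  by split => // -[i j] _; exact: Ac.
pose c := d%:R * `|M|.
have c0 : 0 <= c by rewrite mulr_ge0.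
have Mk k : `|M ^+ k| <= c ^+ k.
  elim: k => [|k ih].
    rewrite !expr0; apply: Mle => // i j.
    by rewrite mxE; case: eqP => _; rewrite ?normr1// normr0.
  apply: Mle => [|i j]; first exact: exprn_ge0.
  rewrite exprS mxE; apply: le_trans (ler_norm_sum _ _ _) _.
  have cE : \sum_(l < d) `|M| * c ^+ k = c ^+ k.+1.
    by rewrite sumr_const card_ord -mulr_natl mulrA -exprS.
  rewrite -cE; apply: ler_sum => l _; rewrite normrM ler_pM//.
  exact: le_trans ih.
have ncvg : cvgn [normed series (fun k : nat => (k`!%:R)^-1 *: M ^+ k)].
  apply: (@series_le_cvg _ _ (exp_coeff c)) => [n|n|n|] /=.
  - by [].
  - by rewrite exp_coeff_ge0.
  - rewrite normrZ ger0_norm ?invr_ge0// /exp_coeff/= mulrC.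
    by rewrite ler_wpM2r ?invr_ge0.
  - exact: is_cvg_series_exp_coeff.
move/cauchy_cvgP/cauchy_seriesP : ncvg => ncvg.
apply/cauchy_cvgP/cauchy_seriesP => e /ncvg; apply: filterS => n /=.
rewrite ger0_norm ?sumr_ge0//.
by apply: le_lt_trans; exact: ler_norm_sum.
Qed.

Lemma jac_mx_jacobian (R : realType) (d : nat) (phi : 'cV[R]_d -> 'cV[R]_d)
    (q : 'cV[R]_d) :
  differentiable phi q ->
  jac_mx phi q = ('J (fun x : 'rV[R]_d => (phi x^T)^T) q^T)^T.
Proof.
move=> dphi.
have trc m n : continuous (@trmx R m n).
  move=> M A /= /(nbhs_ballP M^T) [e e0 eA].
  apply/nbhs_ballP; exists e => //= N [_ MN]; apply: eA.
  by split=> // i j; rewrite !mxE; exact: MN.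
have trD m n (M : 'M[R]_(m, n)) : differentiable (@trmx R m n) M.
  apply: linear_differentiable; exact: trc.
have trd m n (M : 'M[R]_(m, n)) : 'd (@trmx R m n) M = @trmx R m n :> (_ -> _).
  apply: diff_lin; exact: trc.
have dphi' : differentiable phi q^T^T by rewrite trmxK.
have d3 : differentiable (phi \o @trmx R 1 d) q^T.
  by apply: differentiable_comp => //; exact: trD.
apply/matrixP => i j; rewrite mxE /jacobian mxE.
have -> : (fun x : 'rV[R]_d => (phi x^T)^T) = @trmx R d 1 \o (phi \o @trmx R 1 d) by [].
rewrite (diff_comp d3 (trD _ _ _)) /= trd mxE.
rewrite (diff_comp (trD _ _ _) dphi') /= trd trmxK trmx_delta jac_mxE//.
by rewrite -colE !mxE.
Qed.

(* Main.v *)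
(* Write E = exp(hA/2). As A = JD is antisymmetric and commutes with J, E is
   orthogonal with E J E^T = J. Differentiating the step, and with H the Hessian
   of V at the midpoint, Phi = E^2 + (h/2) E J H (E + E^-1 Phi). Hence
   Psi = E^-1 Phi E^-1 satisfies (1 - M) Psi = 1 + M with M = (h/2) J H: it is
   the Cayley transform of M. Since H is symmetric, M J + J M^T = 0, so that
   Psi J Psi^T = J, and Phi = E Psi E preserves J as well. *)

Require Import Defs.
From mathcomp Require Import all_boot all_order all_algebra.
From mathcomp Require Import boolp classical_sets functions reals topology.
From mathcomp Require Import normedtype sequences landau derive exp.
From mathcomp Require Import ring lra.

Set Implicit Arguments.
Unset Strict Implicit.
Unset Printing Implicit Defensive.

Import Order.TTheory GRing.Theory Num.Theory.
Import numFieldNormedType.Exports.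

Local Open Scope classical_set_scope.
Local Open Scope ring_scope.

(** * Cauchy products of truncated exponential series *)

Lemma sum_antidiagonal (V : nmodType) (F : nat -> nat -> V) n :
  \sum_(i < n) \sum_(j < n | (i + j < n)%N) F i j =
  \sum_(k < n) \sum_(i < k.+1) F (k - i)%N i.
Proof.
transitivity (\sum_(k < n) \sum_(i < n | (i <= k)%N) F (k - i)%N i); last first.
  apply: eq_bigr => k _.
  by rewrite (big_ord_widen n (fun i => F (k - i)%N i)) //.
(* Both sides get the second argument of [F] as outer index; the shift [k = i + j] then matches the
   inner sums. *)
rewrite (exchange_big_dep predT) //= [RHS](exchange_big_dep predT) //=.
apply: eq_bigr => j _.
rewrite -(big_mkord (fun k => (j <= k)%N) (fun k => F (k - j)%N j)).
rewrite -(big_nat_widenl j 0 n predT) //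
  -[X in \sum_(X <= _ < _ | _) _](add0n j) big_addn big_mkord.
rewrite (big_ord_widen n (fun i => F (i + j - j)%N j)) ?leq_subr//.
by apply: eq_big => [i|i _]; rewrite ?ltn_subRL ?addnK // addnC.
Qed.

(** Since ['C(k, i) / k! = 1 / ((k - i)! i!)], the terms of total degree below [n] cancel. [G] takes
    values in a module so that the identity serves both for matrix powers and for their real
    majorants. *)
Lemma exp_coeff_product (R : numFieldType) (V : lmodType R)
    (G : nat -> nat -> V) (P : nat -> V) n :
  (forall k, P k = \sum_(i < k.+1) G (k - i)%N i *+ 'C(k, i)) ->
  \sum_(i < n) \sum_(j < n) (i`!%:R^-1 * j`!%:R^-1) *: G i j
    - \sum_(k < n) k`!%:R^-1 *: P k =
  \sum_(i < n) \sum_(j < n | (n <= i + j)%N) (i`!%:R^-1 * j`!%:R^-1) *: G i j.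
Proof.
move=> GP; apply/eqP; rewrite subr_eq; apply/eqP.
under eq_bigr => i _ do rewrite (bigID (fun j : 'I_n => (n <= i + j)%N)) /=.
rewrite big_split /=; congr (_ + _).
under eq_bigr do under eq_bigl do rewrite -ltnNge.
rewrite (@sum_antidiagonal _ (fun i j => (i`!%:R^-1 * j`!%:R^-1) *: G i j)).
apply: eq_bigr => k _; rewrite GP scaler_sumr; apply: eq_bigr => i _.
rewrite -[G _ _ *+ _]scaler_nat scalerA; congr (_ *: _).
have ik : (i <= k)%N by rewrite -ltnS.
rewrite -(bin_fact ik) !natrM !invfM [RHS]mulrAC mulVf ?mul1r 1?[RHS]mulrC//.
by rewrite pnatr_eq0 -lt0n bin_gt0.
Qed.

(** * The entrywise maximum norm and limits of matrices *)

Lemma ler_entry_mx_norm (R : realType) (m n : nat) (A : 'M[R]_(m, n)) i j :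
  `|A i j| <= `|A|.
Proof. by rewrite [leRHS]/Num.norm/= mx_normrE; exact: (le_bigmax _ _ (i, j)). Qed.

Lemma ler_mx_norm (R : realType) (m n : nat) (A : 'M[R]_(m, n)) (c : R) :
  0 <= c -> (forall i j, `|A i j| <= c) -> `|A| <= c.
Proof.
move=> c0 Ac; rewrite [leLHS]/Num.norm/= mx_normrE; apply/bigmax_leP.
by split => // -[i j] _; exact: Ac.
Qed.

(** The maximum norm is not submultiplicative: [n%:R] counts the terms in each entry of the
    product. *)
Lemma ler_mx_normM (R : realType) (m n p : nat) (A : 'M[R]_(m, n))
    (B : 'M[R]_(n, p)) :
  `|A *m B| <= n%:R * `|A| * `|B|.
Proof.
apply: ler_mx_norm => [|i j]; first by rewrite !mulr_ge0.
rewrite mxE; apply: le_trans (ler_norm_sum _ _ _) _.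
rewrite -mulrA mulr_natl -[n in _ *+ n]card_ord -sumr_const ler_sum // => k _.
by rewrite normrM ler_pM ?ler_entry_mx_norm.
Qed.

(** Absorbing the factor [d%:R] of each multiplication into the base makes the bound a real power,
    comparable with the series of [expR]. *)
Lemma ler_mx_normX (R : realType) (d : nat) (A : 'M[R]_d) (k : nat) :
  `|A ^+ k| <= (d%:R * `|A|) ^+ k.
Proof.
elim: k => [|k IH].
  rewrite !expr0; apply: ler_mx_norm => // i j.
  by rewrite mxE; case: eqP => _; rewrite ?normr1// normr0.
rewrite !exprS; apply: le_trans (ler_mx_normM _ _) _.
by rewrite ler_wpM2l // mulr_ge0.
Qed.

Lemma cvg_mx_entries (R : realType) (m n : nat) (T : Type)
    (F : set_system T) {FF : Filter F} (u : T -> 'M[R]_(m, n)) (A : 'M[R]_(m, n)) :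
  (forall i j, u t i j @[t --> F] --> A i j) -> u @ F --> A.
Proof.
move=> uA; apply/cvgrPdist_le => e e0.
have : \forall t \near F, forall ij : 'I_m * 'I_n,
    `|A ij.1 ij.2 - u t ij.1 ij.2| <= e.
  by apply: filter_forall => -[i j] /=; have /cvgrPdist_le := uA i j; exact.
apply: filterS => t ut; apply: ler_mx_norm => [|i j]; first exact: ltW.
by rewrite !mxE; exact: (ut (i, j)).
Qed.

Lemma cvg_mx_entry (R : realType) (m n : nat) (T : Type)
    (F : set_system T) {FF : Filter F} (u : T -> 'M[R]_(m, n))
    (A : 'M[R]_(m, n)) i j :
  u @ F --> A -> u t i j @[t --> F] --> A i j.
Proof.
move=> uA.
exact: (cvg_comp _ _ uA (@coord_continuous R m n i j A)).
Qed.

Lemma cvg_mulmx (R : realType) (m n p : nat) (T : Type)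
    (F : set_system T) {FF : Filter F} (u : T -> 'M[R]_(m, n))
    (v : T -> 'M[R]_(n, p)) (A : 'M[R]_(m, n)) (B : 'M[R]_(n, p)) :
  u @ F --> A -> v @ F --> B -> u t *m v t @[t --> F] --> A *m B.
Proof.
move=> uA vB; apply: cvg_mx_entries => i j; rewrite mxE.
under eq_fun do rewrite mxE.
apply: cvg_big => [|k _]; first exact: add_continuous.
by apply: cvgM; exact: cvg_mx_entry.
Qed.

Lemma cvg_trmx (R : realType) (m n : nat) (T : Type)
    (F : set_system T) {FF : Filter F} (u : T -> 'M[R]_(m, n)) (A : 'M[R]_(m, n)) :
  u @ F --> A -> (u t)^T @[t --> F] --> A^T.
Proof.
move=> uA; apply: cvg_mx_entries => i j; rewrite mxE.
under eq_fun do rewrite mxE.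
exact: cvg_mx_entry.
Qed.

(** * Functional equation, transpose and commutation of the matrix exponential *)

Lemma cvg_mxexp (R : realType) (d : nat) (M : 'M[R]_d) :
  \sum_(k < n) k`!%:R^-1 *: M ^+ k @[n --> \oo] --> mxexp M.
Proof.
under eq_fun do rewrite -(big_mkord predT (fun k => k`!%:R^-1 *: M ^+ k)).
exact: is_cvg_mxexp.
Qed.

Lemma cvg_expR (R : realType) (x : R) :
  \sum_(k < n) k`!%:R^-1 * x ^+ k @[n --> \oo] --> expR x.
Proof.
under eq_fun do rewrite -(big_mkord predT (fun k => k`!%:R^-1 * x ^+ k)).
rewrite /expR.
by have := @is_cvg_series_exp_coeff R x; rewrite {1}exp_coeffE.
Qed.

(* The Cauchy product remainder is dominated by that of the real exponentials of
   d|M| and d|N|, which vanishes in the limit by expRD. *)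
Lemma mxexpD (R : realType) (d : nat) (M N : 'M[R]_d) :
  M *m N = N *m M -> mxexp (M + N) = mxexp M *m mxexp N.
Proof.
move=> MN; pose a := d%:R * `|M|; pose b := d%:R * `|N|.
pose S (X : 'M[R]_d) n := \sum_(k < n) k`!%:R^-1 *: X ^+ k.
pose s (x : R) n := \sum_(k < n) k`!%:R^-1 * x ^+ k.
have SE n : S M n *m S N n - S (M + N) n =
    \sum_(i < n) \sum_(j < n | (n <= i + j)%N)
       (i`!%:R^-1 * j`!%:R^-1) *: (M ^+ i *m N ^+ j).
  rewrite -(@exp_coeff_product _ _ (fun i j => M ^+ i *m N ^+ j)
    (fun k => (M + N) ^+ k)) => [|k]; last first.
    exact: exprDn_comm.
  congr (_ - _); rewrite mulmx_suml; apply: eq_bigr => i _.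
  rewrite mulmx_sumr; apply: eq_bigr => j _.
  by rewrite -scalemxAl -scalemxAr scalerA.
have sE n : s a n * s b n - s (a + b) n =
    \sum_(i < n) \sum_(j < n | (n <= i + j)%N)
       (i`!%:R^-1 * j`!%:R^-1) * (a ^+ i * b ^+ j).
  rewrite -(@exp_coeff_product _ R^o (fun i j => a ^+ i * b ^+ j)
    (fun k => (a + b) ^+ k)) => [|k]; last first.
    by apply: exprDn_comm; exact: mulrC.
  congr (_ - _); rewrite mulr_suml; apply: eq_bigr => i _.
  rewrite mulr_sumr; apply: eq_bigr => j _.
  by rewrite mulrACA.
have a0 : 0 <= a by rewrite mulr_ge0.
have b0 : 0 <= b by rewrite mulr_ge0.
(* The powers carry their dimension factors inside [a] and [b]; the extra [d%:R] comes from the one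
   product [M ^+ i *m N ^+ j]. *)
have Ss n : `|S M n *m S N n - S (M + N) n| <= d%:R * (s a n * s b n - s (a + b) n).
  rewrite SE sE; apply: le_trans (ler_norm_sum _ _ _) _.
  rewrite mulr_sumr; apply: ler_sum => i _.
  apply: le_trans (ler_norm_sum _ _ _) _.
  rewrite mulr_sumr; apply: ler_sum => j _.
  rewrite normrZ ger0_norm ?mulr_ge0 ?invr_ge0// [leRHS]mulrCA ler_wpM2l//.
    by rewrite mulr_ge0 ?invr_ge0.
  apply: le_trans (ler_mx_normM _ _) _; rewrite -mulrA ler_wpM2l//.
  by rewrite ler_pM ?ler_mx_normX.
have s0 : d%:R * (s a n * s b n - s (a + b) n) @[n --> \oo] --> (0 : R).
  rewrite -(mulr0 d%:R) -(subrr (expR (a + b))) {1}expRD.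
  apply: cvgMr; apply: cvgB; last exact: cvg_expR.
  by apply: cvgM; exact: cvg_expR.
have : (S M n *m S N n - S (M + N) n) @[n --> \oo] --> (0 : 'M[R]_d).
  apply/norm_cvg0P; apply: (squeeze_cvgr _ _ s0); last exact: cvg_cst.
  by near=> n; rewrite normr_ge0 Ss.
have : (S M n *m S N n - S (M + N) n) @[n --> \oo] -->
    mxexp M *m mxexp N - mxexp (M + N).
  by apply: cvgB; [apply: cvg_mulmx|]; exact: cvg_mxexp.
move=> /cvg_unique/[apply] /(_ (@norm_hausdorff _ _)) /eqP.
by rewrite subr_eq0 => /eqP.
Unshelve. all: by end_near.
Qed.

Lemma mxexp0 (R : realType) (d : nat) : mxexp (0 : 'M[R]_d) = 1%:M.
Proof.
apply: (cvg_unique (@norm_hausdorff _ _) (cvg_mxexp (M := 0))).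
(* The partial sum is empty for [n = 0] and equals the identity from [n = 1] on, so it is only
   eventually constant. *)
apply: cvg_near_cst; near=> n.
have -> : n = n.-1.+1 by rewrite prednK //; near: n; exists 1%N.
rewrite big_ord_recl /= fact0 invr1 scale1r expr0.
by rewrite big1 ?addr0// => i _; rewrite exprS mul0r scaler0.
Unshelve. all: by end_near.
Qed.

Lemma mxexpNr (R : realType) (d : nat) (M : 'M[R]_d) :
  mxexp M *m mxexp (- M) = 1%:M.
Proof. by rewrite -mxexpD ?mulmxN ?mulNmx// subrr mxexp0. Qed.

Lemma trmx_mxexp (R : realType) (d : nat) (M : 'M[R]_d) :
  (mxexp M)^T = mxexp M^T.
Proof.
have hausM := @norm_hausdorff R 'M[R]_d.
apply: esym; apply: (cvg_unique hausM (cvg_mxexp (M := M^T))).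
have trX k : M^T ^+ k = (M ^+ k)^T.
  by elim: k => [|k IH]; rewrite ?trmx1// exprSr exprS trmx_mul IH.
have trS n : \sum_(k < n) k`!%:R^-1 *: M^T ^+ k =
    (\sum_(k < n) k`!%:R^-1 *: M ^+ k)^T.
  by rewrite linear_sum; apply: eq_bigr => k _; rewrite linearZ trX.
rewrite /= (eq_cvg _ _ trS).
exact: cvg_trmx (cvg_mxexp (M := M)).
Qed.

Lemma mxexp_comm (R : realType) (d : nat) (M N : 'M[R]_d) :
  M *m N = N *m M -> mxexp M *m N = N *m mxexp M.
Proof.
move=> MN.
have cN : (N : 'M[R]_d) @[_ --> \oo] --> N by exact: cvg_cst.
have hausM := @norm_hausdorff R 'M[R]_d.
apply: (cvg_unique hausM (cvg_mulmx (cvg_mxexp (M := M)) cN)).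
have cS n : (\sum_(k < n) k`!%:R^-1 *: M ^+ k) *m N =
    N *m (\sum_(k < n) k`!%:R^-1 *: M ^+ k).
  rewrite mulmx_sumr mulmx_suml; apply: eq_bigr => k _.
  by rewrite -scalemxAl -scalemxAr; congr (_ *: _); exact/esym/commrX/esym.
rewrite /= (eq_cvg _ _ cS).
exact: cvg_mulmx cN (cvg_mxexp (M := M)).
Qed.

(** * Symmetry of second derivatives *)

Lemma is_derive_line (R : numFieldType) (W U : normedModType R) (f : W -> U)
    (a y : W) (t : R) :
  derivable f (t *: a + y) a ->
  is_derive t 1 (fun t => f (t *: a + y)) ('D_a f (t *: a + y)).
Proof.
(* The difference quotients along the line and in direction [a] are the same function of the
   increment. *)
have eq_rate : (fun h : R =>
      h^-1 *: (((fun t => f (t *: a + y)) \o shift t) (h *: 1) - f (t *: a + y))) =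
   (fun h : R => h^-1 *: ((f \o shift (t *: a + y)) (h *: a) - f (t *: a + y))).
  by apply/funext => h /=; rewrite [_%:A]mulr1 scalerDl addrA.
by move=> df; apply: DeriveDef; rewrite /derivable /derive eq_rate.
Qed.

(* Mean value theorem for t |-> f (x + t a + s b) - f (x + t a) on [0, s]. *)
Lemma second_difference (R : realType) (W : normedModType R) (f : W -> R)
    (x a b : W) (e : R) :
  (forall y, derivable f y a) -> differentiable ('D_a f) x -> 0 < e ->
  \forall s \near (0 : R)^'+,
    `|f (s *: a + (s *: b + x)) - f (s *: a + x) - f (s *: b + x) + f x
      - s ^+ 2 * 'd ('D_a f) x b| <= e * s ^+ 2.
Proof.
(* [s * c] bounds the increments [t *: a] and [t *: a + s *: b] for [t] between 0 and [s]; the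
   summand 1 keeps [c] positive when [a] and [b] vanish. *)
move=> df dg e0; pose c := `|a| + `|b| + 1.
have c0 : 0 < c by rewrite ltr_wpDl // addr_ge0.
(* Two Taylor remainders occur, each at most [e / (2 * c) * (s * c) = e * s / 2]; the mean value
   theorem supplies the other factor [s]. *)
have [_ /eqaddoP /(_ (e / (2 * c)))] := (diff_locallyP _ _).1 dg.
rewrite divr_gt0 ?mulr_gt0// => /(_ isT)/nbhs_ballP[r /= r0 dgr].
have dgx h : `|h| < r -> `|'D_a f (h + x) - 'D_a f x - 'd ('D_a f) x h| <=
    e / (2 * c) * `|h|.
  move=> hr; have := dgr h; rewrite -ball_normE /ball_/= sub0r normrN => /(_ hr).
  by rewrite !fctE /= opprD addrA.
near=> s.
have s0 : 0 < s by [].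
have sr : s * c < r by rewrite -ltr_pdivlMr //; near: s; apply: nbhs_right_lt;
  rewrite divr_gt0.
pose u (t : R) := f (t *: a + (s *: b + x)) - f (t *: a + x).
have du (t : R) : is_derive t 1 u
    ('D_a f (t *: a + (s *: b + x)) - 'D_a f (t *: a + x)).
  by apply: is_deriveB; exact: is_derive_line.
have [] := MVT s0 (fun t _ => du t).
  by apply: derivable_within_continuous => t _; have [] := du t.
move=> t /[!in_itv]/= /andP[t0 ts]; rewrite /u !scale0r !add0r subr0 => usE.
have na : `|t *: a| <= s * `|a| by rewrite normrZ ler_wpM2r// gtr0_norm// ltW.
have nb : `|s *: b| = s * `|b| by rewrite normrZ gtr0_norm.
have n1 : `|t *: a + s *: b| <= s * c.
  apply: le_trans (ler_normD _ _) _; rewrite nb /c; nra.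
have n2 : `|t *: a| <= s * c.
  apply: le_trans na _; rewrite /c ler_wpM2l ?(ltW s0)//.
  by rewrite -addrA lerDl addr_ge0.
have g1 := dgx _ (le_lt_trans n1 sr).
have g2 := dgx _ (le_lt_trans n2 sr).
pose l := 'd ('D_a f) x b : R.
have linE : 'd ('D_a f) x (t *: a + s *: b) = 'd ('D_a f) x (t *: a) + s * l.
  by rewrite linearD [in X in _ + X]linearZ.
rewrite linE -[t *: a + _ + x]addrA in g1.
(* The terms in the unknown point [t] cancel between the two expansions of ['D_a f] at [x], leaving
   [s * l]. *)
have -> : f (s *: a + (s *: b + x)) - f (s *: a + x) - f (s *: b + x)
    + f x - s ^+ 2 * l =
   s * (('D_a f (t *: a + (s *: b + x)) - 'D_a f x
       - ('d ('D_a f) x (t *: a) + s * l))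
     - ('D_a f (t *: a + x) - 'D_a f x - 'd ('D_a f) x (t *: a))).
  by have := usE; lra.
rewrite normrM gtr0_norm// expr2 mulrCA ler_wpM2l ?(ltW s0)//.
apply: (le_trans (ler_normB _ _)). apply: (le_trans (lerD g1 g2)).
rewrite -mulrDr mulrAC ler_pdivrMr ?mulr_gt0//.
rewrite -mulrA ler_wpM2l ?(ltW e0)//; lra.
Unshelve. all: by end_near.
Qed.

(** The second difference of [f] is symmetric in [a] and [b], and each mixed derivative times
    [s ^+ 2] approximates it to within [e * s ^+ 2]. *)
Lemma derive_comm (R : realType) (W : normedModType R) (f : W -> R)
    (x a b : W) :
  (forall y, differentiable f y) ->
  differentiable ('D_a f) x -> differentiable ('D_b f) x ->
  'D_b ('D_a f) x = 'D_a ('D_b f) x.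
Proof.
move=> df da db.
pose lab : R := 'd ('D_a f) x b; pose lba : R := 'd ('D_b f) x a.
transitivity lab; first exact: deriveE.
transitivity lba; last by rewrite deriveE.
apply/eqP; rewrite -subr_eq0; apply/negPn/negP => n0.
(* The two errors add up to [2 * e], half of the supposed gap, which is a contradiction. *)
pose e := `|lab - lba| / 4.
have e0 : 0 < e by rewrite divr_gt0 ?normr_gt0.
near (0 : R)^'+ => s.
have s0 : 0 < s by [].
have hab : `|f (s *: a + (s *: b + x)) - f (s *: a + x) - f (s *: b + x) + f x
      - s ^+ 2 * lab| <= e * s ^+ 2.
  near: s; apply: second_difference => // y; exact: diff_derivable.
have hba : `|f (s *: b + (s *: a + x)) - f (s *: b + x) - f (s *: a + x) + f x
      - s ^+ 2 * lba| <= e * s ^+ 2.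
  near: s; apply: second_difference => // y; exact: diff_derivable.
have s2 : 0 < s ^+ 2 by rewrite exprn_gt0.
have : s ^+ 2 * `|lab - lba| <= s ^+ 2 * (2 * e).
  rewrite -{1}(gtr0_norm s2) -normrM.
  have -> : s ^+ 2 * (2 * e) = e * s ^+ 2 + e * s ^+ 2 by ring.
  apply: le_trans (lerD hba hab); apply: le_trans (ler_normB _ _).
  rewrite (addrCA (s *: b)).
  by rewrite le_eqVlt; apply/orP; left; apply/eqP; congr `|_|; ring.
rewrite ler_pM2l// => le2e.
have : 0 < `|lab - lba| by rewrite normr_gt0.
have : e * 4 = `|lab - lba| by rewrite /e divfK ?pnatr_eq0.
lra.
Unshelve. all: by end_near.
Qed.

Lemma trmx_hessian (R : realType) (d : nat) (V : 'cV[R]_d -> R) (q : 'cV[R]_d) :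
  (forall x, differentiable V x) -> differentiable (gradient V) q ->
  (jac_mx (gradient V) q)^T = jac_mx (gradient V) q.
Proof.
move=> dV dg.
have gE i : (fun x => gradient V x i ord0) = 'D_(basis_vec R i) V.
  by apply/funext => x; rewrite mxE.
have dgi i : differentiable ('D_(basis_vec R i) V) q.
  rewrite -gE; apply: (differentiable_comp
    (g := fun M : 'cV[R]_d => M i ord0)) => //.
  exact: differentiable_coord.
by apply/matrixP => i j; rewrite !mxE !gE derive_comm.
Qed.

(** * Cayley transforms, the Jacobian of the step and its Poisson property *)

Lemma eq_mulmx_cV (R : pzSemiRingType) (m n : nat) (A B : 'M[R]_(m, n)) :
  (forall v : 'cV_n, A *m v = B *m v) -> A = B.
Proof.
move=> AB; apply/matrixP => i j; have /colP/(_ i) := AB (delta_mx j ord0).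
by rewrite -!colE !mxE.
Qed.

(** Multiplying the claim by [1%:M - M] on the left and by its transpose on the right gives [(1 + M)
    J (1 + M)^T = (1 - M) J (1 - M)^T]. The mixed terms [M J + J M^T] vanish, so both sides are
    [J + M J M^T]. *)
Lemma cayley_poisson (R : realType) (d : nat) (J M Psi : 'M[R]_d) :
  M *m J = - (J *m M^T) -> (1%:M - M) *m Psi = 1%:M + M ->
  Psi *m J *m Psi^T = J.
Proof.
move=> MJ PsiE.
(* The equation for [Psi] forces invertibility: rows annihilated by [1 - M] are annihilated by
   [1 + M], hence by the sum 2. *)
have uM : 1%:M - M \in unitmx.
  rewrite -row_free_unit -kermx_eq0; set K := kermx _.
  have KM : K *m (1%:M - M) = 0 by exact: mulmx_ker.
  have : K *m (1%:M + M) = 0 by rewrite -PsiE mulmxA KM mul0mx.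
  move/eqP: KM; rewrite mulmxBr mulmxDr mulmx1 subr_eq0 => /eqP <-.
  move/eqP; rewrite -mulr2n -scaler_nat scaler_eq0 pnatr_eq0 /=.
  by [].
have tuM : (1%:M - M)^T \in unitmx by rewrite unitmx_tr.
apply: (can_inj (mulmxK tuM)); apply: (can_inj (mulKmx uM)).
rewrite -!mulmxA -trmx_mul PsiE !mulmxA PsiE.
rewrite !linearD !linearN /= trmx1.
rewrite !(mulmxDl, mulmxDr, mul1mx, mulmx1, mulNmx, mulmxN).
by rewrite MJ !mulNmx !opprK addrA subrK opprD addrA addrK.
Qed.

Lemma is_diff_mulmx (R : realType) (W : normedModType R) (m n p : nat)
    (A : 'M[R]_(m, n)) (f df : W -> 'M[R]_(n, p)) (x : W) :
  is_diff x f df -> is_diff x (fun y => A *m f y) (fun v => A *m df v).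
Proof.
move=> fdf; have Ac : continuous (mulmx A : 'M[R]_(n, p) -> 'M[R]_(m, p)).
  move=> B; have cA : (fun _ : 'M[R]_(n, p) => A) @ nbhs B --> A by apply: cvg_cst.
  by apply: (cvg_mulmx cA); exact: cvg_id.
have dA : is_diff (f x) (mulmx A) (mulmx A : 'M[R]_(n, p) -> 'M[R]_(m, p)).
  by apply: DiffDef; [exact: linear_differentiable|exact: diff_lin].
exact: (is_diff_comp fdf dA).
Qed.

(** Chain rule applied to the implicit step. As [phi] also occurs in [mid], its Jacobian remains on
    both sides. The step equation is differentiated, so it is assumed on a neighbourhood of [q]. *)
Lemma jac_mx_step (R : realType) (d : nat) (J E0 E E' : 'M[R]_d)
    (g phi : 'cV[R]_d -> 'cV[R]_d) (h : R) (q : 'cV[R]_d) :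
  let mid x := 2^-1 *: (E *m x + E' *m phi x) in
  (forall x, differentiable g x) -> differentiable phi q ->
  (\near q, phi q = E0 *m q + h *: (E *m (J *m g (mid q)))) ->
  jac_mx phi q = E0 + h *: (E *m J *m jac_mx g (mid q) *m
                     (2^-1 *: (E + E' *m jac_mx phi q))).
Proof.
move=> mid dg dphi phiE; apply: eq_mulmx_cV => v.
have did : is_diff q id (id : 'cV[R]_d -> _) by exact: is_diff_id.
have dp : is_diff q phi (mulmx (jac_mx phi q)).
  by apply: DiffDef => //; apply/funext => w; rewrite jac_mxE.
have dmid : is_diff q mid
    (fun w => 2^-1 *: (E *m w + E' *m (jac_mx phi q *m w))).
  by apply: is_diffZ; apply: is_diffD; exact: is_diff_mulmx.
have dgm : is_diff (mid q) g (mulmx (jac_mx g (mid q))).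
  by apply: DiffDef => //; apply/funext => w; rewrite jac_mxE.
have dgmid := is_diff_comp dmid dgm.
have dstep := is_diffD (is_diff_mulmx E0 did)
  (is_diffZ h (is_diff_mulmx E (is_diff_mulmx J dgmid))).
rewrite -jac_mxE // -deriveE // (near_eq_derive v phiE).
have [ds dsE] := dstep.
rewrite deriveE // dsE !fctE mulmxDl -scalemxAl -!mulmxA -scalemxAl mulmxDl.
by rewrite -mulmxA.
Qed.

Theorem theorem1 (R : realType) (d : nat) (J D : 'M[R]_d)
    (hJ : J^T = - J) (hD : D^T = D) (hJD : J *m D = D *m J)
    (V : 'cV[R]_d -> R) (hV : twice_cont_diff V)
    (h : R) (U : set 'cV[R]_d) (hU : open U)
    (phi : 'cV[R]_d -> 'cV[R]_d)
    (hphi : forall q, U q -> differentiable phi q)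
    (hstep : forall q, U q ->
       exp_midpoint_step (J *m D) (fun x => J *m gradient V x) h q (phi q)) :
  forall q, U q -> preserves_poisson_at J phi q.
Proof.
move=> q Uq; have [dV dg _] := hV; rewrite /preserves_poisson_at.
set A := (h / 2) *: (J *m D); set E := mxexp A; set E' := mxexp (- A).
have EE' : E *m E' = 1%:M by exact: mxexpNr.
have E'E : E' *m E = 1%:M by exact: mulmx1C.
have trA : A^T = - A.
  by rewrite linearZ /= trmx_mul hJ hD mulmxN -hJD scalerN.
have trE : E^T = E' by rewrite trmx_mxexp trA.
have EJ : E *m J = J *m E.
  by apply: mxexp_comm; rewrite -scalemxAl -scalemxAr -mulmxA hJD.
have E0 : mxexp (h *: (J *m D)) = E *m E.
  by rewrite -mxexpD // -scalerDl -splitr.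
have phiE : \near q, phi q = E *m E *m q +
    h *: (E *m (J *m gradient V (2^-1 *: (E *m q + E' *m phi q)))).
  (* Openness of [U] turns the pointwise step equation into one valid near [q]. *)
  have : \near q, U q by exact: open_nbhs_nbhs.
  apply: filterS => x /hstep; rewrite /exp_midpoint_step E0 scaleNr -/A.
  exact.
have := jac_mx_step dg (hphi q Uq) phiE.
set Phi := jac_mx phi q; set H := jac_mx (gradient V) _ => PhiE.
have trH : H^T = H by exact: trmx_hessian.
pose M := (h / 2) *: (J *m H); pose Psi := E' *m Phi *m E'.
have MJ : M *m J = - (J *m M^T).
  by rewrite linearZ /= trmx_mul hJ trH mulmxN
    -scalemxAr mulmxN scalerN opprK -scalemxAl mulmxA.
have PsiE : (1%:M - M) *m Psi = 1%:M + M.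
  (* The Jacobian equation multiplied by [E'] on both sides: [E' E E E' = 1] and
     [(E + E' Phi) E' = 1 + Psi], while [h] and [2^-1] merge into [M]. *)
  have : Psi = 1%:M + M *m (1%:M + Psi).
    rewrite {1}/Psi PhiE [in LHS]mulmxDr [in LHS]mulmxDl; congr (_ + _).
      by rewrite !mulmxA E'E mul1mx EE'.
    rewrite /M /Psi -!scalemxAr -!scalemxAl scalerA; congr (_ *: _).
    by rewrite !mulmxA E'E mul1mx -[LHS]mulmxA mulmxDl EE'.
  by move=> PsiE; rewrite mulmxBl mul1mx {1}PsiE mulmxDr mulmx1 addrA addrK.
have PhiPsi : Phi = E *m Psi *m E.
  by rewrite /Psi -!mulmxA E'E mulmx1 mulmxA EE' mul1mx.
have PJ := cayley_poisson MJ PsiE.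
have EJE' : E *m J *m E' = J by rewrite EJ -mulmxA EE' mulmx1.
(* As [E^T = E'], the identity [E J E' = J] applies twice: inside, before the Cayley step, and
   outside, after it. *)
transitivity (E *m (Psi *m (E *m J *m E') *m Psi^T) *m E').
  by rewrite PhiPsi !trmx_mul trE !mulmxA.
by rewrite EJE' PJ EJE'.
Qed.
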